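(* Let $\mathscr{I}$ be a non-empty set. For each $i\in\mathscr{I}$ let $\lambda_i\geqslant 1$ be a cardinal, let $S_i$ be a Hausdorff $H$-closed (resp., sequentially pseudocompact) semitopological monoid with zero, and let $\big(B^0_{\lambda_i}(S_i),\tau^0_{B(S_i)}\big)$ be a Hausdorff pseudocompact topological Brandt $\lambda_i^0$-extension of $S_i$. Then the direct product $\prod\big\{\big(B^0_{\lambda_i}(S_i),\tau^0_{B(S_i)}\big)\colon i\in\mathscr{I}\big\}$ with the Tychonoff topology is a Hausdorff $H$-closed (resp., sequentially pseudocompact) semitopological semigroup.
   Context: The statement comprises two assertions: one for ''$H$-closed'' and one for ''sequentially pseudocompact''. All topological spaces are Hausdorff. A semitopological semigroup is a Hausdorff topological space with a separately continuous associative operation; a semitopological monoid is a semitopological semigroup with identity. Direct products of semigroups carry the coordinatewise operation. Brandt $\lambda^0$-extension: for a monoid $S$ with zero $0_S$ and a cardinal $\lambda\geqslant 1$, $B^0_\lambda(S)$ is the set $\{(\alpha,s,\beta)\colon \alpha,\beta\in\lambda,\ s\in S\setminus\{0_S\}\}\sqcup\{0\}$ with the operation in which $0$ is the zero and $(\alpha,a,\beta)\cdot(\gamma,b,\delta)$ equals $(\alpha,ab,\delta)$ if $\beta=\gamma$ and $ab\neq 0_S$, and equals $0$ otherwise. For $\alpha,\beta\in\lambda$ put $S_{\alpha,\beta}=\{(\alpha,s,\beta)\colon s\in S\setminus\{0_S\}\}\cup\{0\}$. Topological Brandt $\lambda^0$-extension: for a semitopological monoid $(S,\tau)$ with zero,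 it is $B^0_\lambda(S)$ with a Hausdorff topology $\tau_B$ such that $(B^0_\lambda(S),\tau_B)$ is a semitopological semigroup and, for some $\alpha\in\lambda$, the map $0_S\mapsto 0$, $s\mapsto(\alpha,s,\alpha)$ ($s\neq 0_S$) is a homeomorphism of $(S,\tau)$ onto the subspace $S_{\alpha,\alpha}$. A Hausdorff space is pseudocompact if every locally finite family of non-empty open subsets of it is finite (equivalently, each locally finite open cover is finite); no Tychonoff separation is assumed. A space $X$ is $H$-closed if $X$ is Hausdorff and is a closed subspace of every Hausdorff space in which it is contained. A space $X$ is sequentially pseudocompact if for each sequence $\{U_n\colon n\in\mathbb{N}\}$ of non-empty open subsets of $X$ there exist a point $x\in X$ and an infinite set $M\subseteq\mathbb{N}$ such that for each neighbourhood $U$ of $x$ the set $\{n\in M\colon U_n\cap U=\varnothing\}$ is finite. *)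

(* Defs.v *)
From HB Require Import structures.
From mathcomp Require Import all_boot.
From mathcomp Require Import all_classical.
From mathcomp Require Import topology function_spaces.

Set Implicit Arguments.
Unset Strict Implicit.
Unset Printing Implicit Defensive.

Local Open Scope classical_set_scope.

(* A topology on a fixed carrier is an instance of the class Topological, so that
   several topologies can be considered on one set. The class also contains a
   choice operator, which exists on every type and carries no topological
   information. *)
Definition topology_on (T : Type) : Type := Topological.axioms_ T.

Definition space_of (T : Type) (tau : topology_on T) : topologicalType :=
  Topological.Pack tau.

Definition homeomorphism_onto (X Y : topologicalType) (f : X -> Y)
    (A : set Y) : Prop :=
  [/\ set_bij [set: X] A f,
      continuous f &
      forall U : set X, open U -> exists2 V : set Y, open V & f @` U = A `&` V].

(* "X is contained in Y" means that X is a subspace of Y, up to homeomorphism. *)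
Definition H_closed (X : topologicalType) : Prop :=
  hausdorff_space X /\
  forall (Y : topologicalType) (f : X -> Y),
    hausdorff_space Y -> homeomorphism_onto f (range f) -> closed (range f).

Definition locally_finite (X : topologicalType) (F : set (set X)) : Prop :=
  forall x : X, exists2 U : set X,
    nbhs x U & finite_set [set V | F V /\ V `&` U !=set0].

(* Meant for Hausdorff spaces; no Tychonoff separation is involved. *)
Definition pseudocompact (X : topologicalType) : Prop :=
  forall F : set (set X),
    (forall V, F V -> open V /\ V !=set0) -> locally_finite F -> finite_set F.

Definition sequentially_pseudocompact (X : topologicalType) : Prop :=
  forall U_ : nat -> set X,
    (forall n, open (U_ n) /\ U_ n !=set0) ->
    exists (x : X) (M : set nat), infinite_set M /\
      forall U : set X, nbhs x U ->
        finite_set [set n | M n /\ U_ n `&` U = set0].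

Definition semitopological_semigroup (X : topologicalType)
    (op : X -> X -> X) : Prop :=
  [/\ hausdorff_space X,
      associative op,
      forall a : X, continuous (fun x : X => op a x) &
      forall a : X, continuous (fun x : X => op x a)].

Record semitopologicalMonoid0 : Type := SemitopologicalMonoid0 {
  smspace :> topologicalType;
  smmul : smspace -> smspace -> smspace;
  smone : smspace;
  smzero : smspace;
  smsemigroup : semitopological_semigroup smmul;
  smmul1l : left_id smone smmul;
  smmul1r : right_id smone smmul;
  smmul0l : left_zero smzero smmul;
  smmul0r : right_zero smzero smmul }.

(* The cardinal lambda is represented by an index type L. *)
Inductive brandt (S : semitopologicalMonoid0) (L : Type) : Type :=
  | BrandtZero
  | BrandtElt of L & {s : S | s != smzero S} & L.

Arguments BrandtZero {S L}.

(* (a, s, b) when s <> 0_S, and the zero of the extension when s = 0_S *)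
Definition brandt_elt (S : semitopologicalMonoid0) (L : Type)
    (a : L) (s : S) (b : L) : brandt S L :=
  if insub s is Some u then BrandtElt a u b else BrandtZero.

Definition brandt_mul (S : semitopologicalMonoid0) (L : Type)
    (x y : brandt S L) : brandt S L :=
  match x, y with
  | BrandtElt a s b, BrandtElt c t d =>
      if `[< b = c >] then brandt_elt a (smmul (val s) (val t)) d
      else BrandtZero
  | _, _ => BrandtZero
  end.

Definition brandt_block (S : semitopologicalMonoid0) (L : Type) (a b : L) :
    set (brandt S L) :=
  [set x | x = BrandtZero \/ exists s, x = BrandtElt a s b].

Definition topological_brandt (S : semitopologicalMonoid0) (L : Type)
    (tau : topology_on (brandt S L)) : Prop :=
  semitopological_semigroup (@brandt_mul S L : space_of tau -> space_of tau -> space_of tau) /\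
  exists a : L,
    homeomorphism_onto ((fun s => brandt_elt a s a) : S -> space_of tau)
                       (brandt_block a a).

Definition product_mul (I : Type) (X : I -> topologicalType)
    (op : forall i, X i -> X i -> X i) (x y : prod_topology X) :
    prod_topology X :=
  fun i => op i (x i) (y i).

(* Main.v *)
Require Import Defs.
From HB Require Import structures.
From mathcomp Require Import all_boot.
From mathcomp Require Import all_classical.
From mathcomp Require Import topology function_spaces.

(** Both assertions split into a statement about one extension and a
    productivity theorem.

    One extension. Let [B] be a pseudocompact topological Brandt extension of
    [S]. The pieces [P (a, b) = {(a, s, b) | s <> 0}] are pairwise disjoint and cover [B] minus
    its zero; each is open, being the set of [x] with [(a,1,a) x (b,1,b) <> 0],
    and each is covered by the image of [S] under the continuous map
    [s |-> (a, s, b)]. If [V] is a neighbourhood of zero, the non-empty sets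
    among the [P j `\` closure V] form a locally finite family of open sets, so
    pseudocompactness makes it finite: outside [closure V] only finitely many
    pieces remain ([star_finite_rest]).
    - H-closedness: suppose [B] lies in a Hausdorff space [Y] and [y] outside [B]
      adheres to [B]. Separating [y] from zero leaves, near [y], only points of
      finitely many images of [S], which are closed in [Y] because [S] is
      H-closed; hence [y] belongs to one of them ([star_H_closed]).
    - Sequential pseudocompactness: either infinitely many [U_n] meet one piece,
      and an accumulation point is found in the image of [S]; or every piece is
      met by finitely many [U_n] only, and then zero is an accumulation point of
      the whole sequence ([star_sequentially_pseudocompact]).

    Products. A Hausdorff space is H-closed iff every ultrafilter [F] has a
    theta-limit, i.e. a point [x] such that the closure of each neighbourhood of
    [x] belongs to [F]: the open members of an ultrafilter without theta-limit are
    the traces of the open neighbourhoods of a new point in a Hausdorff one-point extension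
    ([H_closed_theta_compact]), and theta-limits survive in continuous images
    ([theta_compact_closed_range]). Theta-limits are found coordinatewise, as in
    the ultrafilter proof of Tychonoff's theorem ([prod_theta_compact]).
    For sequential pseudocompactness, shrink each [U_n] to a box constraining
    finitely many coordinates. Altogether only countably many coordinates are
    constrained; a diagonal argument produces one infinite [M] that works for all
    of them, and the other coordinates are arbitrary
    ([prod_sequentially_pseudocompact]). *)

Set Implicit Arguments.
Unset Strict Implicit.
Unset Printing Implicit Defensive.

Local Open Scope classical_set_scope.

(** * H-closed spaces and ultrafilters *)

(** The hypothesis [forall A, F A \/ F (~` A)] says that [F] is an ultrafilter,
    in the form that passes to image filters without any surjectivity
    assumption. *)
Definition theta_compact (X : topologicalType) : Prop :=
  forall F : set_system X, ProperFilter F -> (forall A, F A \/ F (~` A)) ->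
  exists x : X, forall V : set X, nbhs x V -> F (closure V).

(** The space [X] with a point [None] adjoined, whose open neighbourhoods trace
    on [X] the open members of [F]; [FF] is a parameter of the type because the
    axioms of a topology hold only for a filter. *)
Definition one_point_ext (X : topologicalType) (F : set_system X)
  (FF : Filter F) : Type := option X.

Section OnePointExtension.
Variables (X : topologicalType) (F : set_system X) (FF : Filter F).
Local Notation Y := (one_point_ext FF).

HB.instance Definition _ := Choice.copy Y (option X).

Definition ext_open (W : set Y) : Prop :=
  open ((Some : X -> Y) @^-1` W) /\
  (W None -> F ((Some : X -> Y) @^-1` W)).

Lemma ext_openT : ext_open setT.
Proof. by split=> [|_]; [exact: openT|exact: filterT]. Qed.

Lemma ext_openI : setI_closed ext_open.
Proof.
move=> A B [oA FA] [oB FB]; split; first exact: openI.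
by move=> [/FA + /FB]; exact: filterI.
Qed.

Lemma ext_open_bigcup (J : Type) (f : J -> set Y) :
  (forall j, ext_open (f j)) -> ext_open (\bigcup_j f j).
Proof.
move=> of_; split; first by apply: bigcup_open => j _; case: (of_ j).
move=> [j _ fj]; have [_ /(_ fj)] := of_ j.
by apply: filterS => x fjx; exists j.
Qed.

HB.instance Definition _ :=
  isOpenTopological.Build Y ext_openT ext_openI ext_open_bigcup.

Lemma ext_open_image (U : set X) : open U -> open ((Some : X -> Y) @` U).
Proof.
move=> oU; split; last by case.
suff -> : (Some : X -> Y) @^-1` [set Some x | x in U] = U by [].
by apply/seteqP; split=> [x [y Uy [<-]]|x Ux] //; exists x.
Qed.

Lemma ext_homeomorphism : homeomorphism_onto (Some : X -> Y) (range Some).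
Proof.
split; first by split=> //; move=> x y _ _ [].
- by apply/continuousP => W [].
- move=> U oU; exists [set Some x | x in U]; first exact: ext_open_image.
  by apply/seteqP; split=> [_ [x Ux <-]|y []//]; split; exists x.
Qed.

(** The new point can be separated from [x] exactly when some neighbourhood of
    [x] has a closure whose complement is in [F]. *)
Lemma ext_hausdorff : hausdorff_space X ->
  (forall x : X, exists2 V : set X, nbhs x V & F (~` closure V)) ->
  hausdorff_space Y.
Proof.
move=> hX sep.
have sepN x : exists A B : set Y,
    [/\ open A, open B, A (Some x), B None & A `&` B = set0].
  have [V Vx FV] := sep x.
  exists [set Some z | z in V°], (None |` [set Some z | z in ~` closure V]).
  split.
  - by apply: ext_open_image; exact: open_interior.
  - have E : (Some : X -> Y) @^-1` (None |` [set Some z | z in ~` closure V])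
        = ~` closure V.
      by apply/seteqP; split=> [z [//|[t Vt [<-]]]|z Vz] //; right; exists z.
    split; rewrite E //; exact/closed_openC/closed_closure.
  - by exists x.
  - by left.
  - apply/seteqP; split=> // _ [[z Vz <-]] [//|[t Vt [tz]]].
    by apply: Vt; apply: subset_closure; rewrite tz; exact: interior_subset.
rewrite open_hausdorff => -[x|] [y|] //= xy.
- have xy' : x != y by apply: contra_neq xy => ->.
  move: hX; rewrite open_hausdorff => /(_ _ _ xy')[[A B] [/= Ax By] [oA oB AB]].
  exists ([set Some z | z in A], [set Some z | z in B]) => /=.
    by move: Ax By; rewrite !inE => Ax By; split; [exists x|exists y].
  split; [exact: ext_open_image|exact: ext_open_image|].
  apply/eqP/seteqP; split=> // _ [[z Az <-] [t Bt [tz]]].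
  by move/eqP/seteqP: AB => [/(_ z) AB _]; apply: AB; split; rewrite -?tz// tz.
- have [A [B [oA oB Ax By AB]]] := sepN x.
  by exists (A, B) => /=; [rewrite !inE|split=> //; exact/eqP].
- have [A [B [oA oB Ax By AB]]] := sepN y.
  by exists (B, A) => /=; [rewrite !inE|split=> //; rewrite setIC; exact/eqP].
Qed.

End OnePointExtension.

(** An ultrafilter without theta-limit contains, around each point, the
    complement of the closure of a neighbourhood; so its one-point extension is
    Hausdorff, yet the new point is not isolated since the empty set is not
    in [F]. *)
Lemma H_closed_theta_compact (X : topologicalType) :
  H_closed X -> theta_compact X.
Proof.
move=> [hX cX] F PF FP; apply: contrapT => nx.
have sep (x : X) : exists2 V : set X, nbhs x V & F (~` closure V).
  apply: contrapT => nV; apply: nx; exists x => V Vx.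
  by case: (FP (closure V)) => // FV; case: nV; exists V.
have FF : Filter F by exact: filter_filter.
have := cX _ _ (ext_hausdorff (FF := FF) hX sep) (ext_homeomorphism FF).
move=> /closed_openC [_ /(_ _)].
have E : (Some : X -> one_point_ext FF) @^-1` (~` range Some) = set0.
  by apply/seteqP; split=> // x; apply; exists x.
by rewrite E => H; apply: (@filter_not_empty _ F); apply: H; case.
Qed.

(** A theta-limit [x] of an ultrafilter refining the trace on [X] of the
    neighbourhoods of an adherent point [y] must satisfy [f x = y]: disjoint
    neighbourhoods of [f x] and [y] would pull back to an open set of the
    ultrafilter missing the closure of a neighbourhood of [x]. *)
Lemma theta_compact_closed_range (X Y : topologicalType) (f : X -> Y) :
  theta_compact X -> hausdorff_space Y -> continuous f -> closed (range f).
Proof.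
move=> tX hY cf y yf; apply: contrapT => nfy.
pose G := filter_from (nbhs y) (fun W => f @^-1` W).
have PG : ProperFilter G.
  apply: filter_from_proper; last first.
    by move=> W /yf[_ [[x _ <-] Wx]]; exists x.
  apply: filter_from_filter; first by exists setT; exact: filterT.
  by move=> A B yA yB; exists (A `&` B) => //; exact: filterI.
have [U [UU GU]] := ultraFilterLemma PG.
have [x xU] := tX U _ (fun A => in_ultra_setVsetC A UU).
have fxy : f x != y by apply/eqP => fxy; apply: nfy; exists x.
move: hY; rewrite open_hausdorff => /(_ _ _ fxy)[[A B] [/= Ax By] [oA oB AB]].
rewrite !inE in Ax By.
have UA : U (closure (f @^-1` A)).
  by apply: xU; apply: cf; exact: open_nbhs_nbhs.
have UB : U (f @^-1` B) by apply: GU; exists B => //; exact: open_nbhs_nbhs.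
have [z [zA zB]] := filter_ex (filterI UA UB).
have [|t [At Bt]] := zA (f @^-1` B).
  by apply: open_nbhs_nbhs; split=> //; exact: (continuousP _).1.
by move/eqP/seteqP: AB => [/(_ (f t)) AB _]; exact: AB.
Qed.

Lemma theta_compact_H_closed (X : topologicalType) :
  hausdorff_space X -> theta_compact X -> H_closed X.
Proof.
move=> hX tX; split=> // Y f hY [_ cf _]; exact: theta_compact_closed_range.
Qed.

(** * Products *)

Section Products.
Variables (I : Type) (X : I -> topologicalType).
Local Notation PX := (prod_topology X).

Lemma prod_proj_continuous (i : I) : continuous (fun x : PX => x i).
Proof. exact: (@proj_continuous {classic I} X i). Qed.

Lemma prod_hausdorff : (forall i, hausdorff_space (X i)) -> hausdorff_space PX.
Proof. exact: (@hausdorff_product {classic I} X). Qed.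

Lemma prod_cvg (F : set_system PX) (x : PX) : Filter F ->
  (forall i V, nbhs (x i) V -> F [set y | V (y i)]) -> F --> x.
Proof.
move=> FF Fx; apply/cvg_sup => i A [_ [[B oB <-] Bx] BA].
by apply: filterS BA _; apply: Fx; exact: open_nbhs_nbhs.
Qed.

(** The sets containing a box form a filter that converges to [x] coordinatewise,
    hence in the product, so they include all neighbourhoods of [x]. This is how
    the description of neighbourhoods is obtained without unfolding the subbase
    of the product topology. *)
Lemma prod_nbhs_box (x : PX) (U : set PX) : nbhs x U ->
  exists (D : seq {classic I}) (V : forall i, set (X i)),
    (forall i, nbhs (x i) (V i)) /\
    [set y : PX | forall i, i \in D -> V i (y i)] `<=` U.
Proof.
pose F : set_system PX := fun U =>
  exists (D : seq {classic I}) (V : forall i, set (X i)),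
    (forall i, nbhs (x i) (V i)) /\
    [set y : PX | forall i, i \in D -> V i (y i)] `<=` U.
have FF : Filter F.
  split.
  - by exists [::], (fun=> setT); split=> // i; exact: filterT.
  - move=> A B [D [V [Vx VA]]] [E [W [Wx WB]]].
    exists (D ++ E), (fun i => V i `&` W i); split.
      by move=> i; exact: filterI.
    move=> y yVW; split; [apply: VA|apply: WB] => i iD;
      by have [] := yVW i; rewrite ?mem_cat ?iD ?orbT.
  - move=> A B AB [D [V [Vx VA]]]; exists D, V; split=> //.
    exact: subset_trans AB.
suff /(_ U) : F --> x by [].
apply: prod_cvg => i V Vx.
(* The box constraining the coordinate [i] alone, as a family over all [j]. *)
have [W Wx WV] : exists2 W : forall j, set (X j), (forall j, nbhs (x j) (W j)) &
   W i = V.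
  exists (fun j => [set z | forall e : i = j, V (ecast j (X j) (esym e) z)]).
    move=> j; have [e|ne] := pselect (i = j).
      subst j; apply: filterS Vx => z Vz e.
      by rewrite (Prop_irrelevance e erefl).
    by apply: filterS filterT => z _ e.
  apply/seteqP; split=> [z /(_ erefl)//|z Vz e].
  by rewrite (Prop_irrelevance e erefl).
exists [:: i : {classic I}], W; split=> // y /(_ i).
by rewrite inE eqxx WV; exact.
Qed.

(** The theta-limits of the image ultrafilters assemble to a theta-limit: the
    closure of a box is the box of the closures, and finitely many coordinates
    are constrained. *)
Lemma prod_theta_compact :
  (forall i, theta_compact (X i)) -> theta_compact PX.
Proof.
move=> tX F PF FP.
have /(_ _)/cid Hx i : exists x : X i, forall V : set (X i), nbhs x V ->
    F [set y : PX | closure V (y i)].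
  apply: (tX i ((fun y : PX => y i) @ F)) => A.
  exact: FP ((fun y : PX => y i) @^-1` A).
exists (fun i => sval (Hx i)) => U /prod_nbhs_box[D [V [Vx VU]]].
have FV : F [set y : PX |
    forall i : {classic I}, i \in D -> closure (V i) (y i)].
  elim: D {VU} => [|i D IH]; first by apply: filterS filterT.
  have FVi := svalP (Hx i) _ (Vx i).
  apply: filterS (filterI FVi IH) => y [yi yD] j.
  by rewrite inE => /orP[/eqP ->|/yD].
apply: filterS FV => y yV W /prod_nbhs_box[E [T [Ty TW]]].
have /(_ _)/cid Hz i : exists z : X i,
    T i z /\ (i \in (D : seq {classic I}) -> V i z).
  have [iD|iD] := boolP (i \in (D : seq {classic I})).
    by have [z []] := yV i iD _ (Ty i); exists z.
  by exists (y i); split=> //; exact: nbhs_singleton.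
exists (fun i => sval (Hz i)); split.
  by apply: VU => i iD; case: (svalP (Hz i)) => _; exact.
by apply: TW => i _; case: (svalP (Hz i)).
Qed.

Lemma prod_H_closed : (forall i, H_closed (X i)) -> H_closed PX.
Proof.
move=> hX; apply: theta_compact_H_closed.
  by apply: prod_hausdorff => i; case: (hX i).
by apply: prod_theta_compact => i; exact: H_closed_theta_compact.
Qed.

Lemma prod_semitopological (op : forall i, X i -> X i -> X i) :
  (forall i, semitopological_semigroup (op i)) ->
  semitopological_semigroup (product_mul op).
Proof.
move=> H; split.
- by apply: prod_hausdorff => i; case: (H i).
- move=> x y z; apply: functional_extensionality_dep => i.
  by case: (H i) => _ assoc _ _; exact: assoc.
- move=> a x; apply: prod_cvg; first exact/fmap_filter/nbhs_filter.
  move=> i V Vx.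
  have [_ _ cl _] := H i.
  exact: (@prod_proj_continuous i x _ (cl (a i) (x i) _ Vx)).
- move=> a x; apply: prod_cvg; first exact/fmap_filter/nbhs_filter.
  move=> i V Vx.
  have [_ _ _ cr] := H i.
  exact: (@prod_proj_continuous i x _ (cr (a i) (x i) _ Vx)).
Qed.

End Products.

(** * Sequential pseudocompactness of products *)

Lemma finite_nat_bounded (A : set nat) :
  finite_set A -> exists n, A `<=` `I_n.
Proof.
move=> /finite_seqP[s ->]; exists (\max_(i <- s) i).+1 => i /= si.
by rewrite ltnS; exact: leq_bigmax_seq.
Qed.

Lemma infinite_nat_unbounded (A : set nat) n :
  infinite_set A -> exists2 m, A m & n <= m.
Proof.
move=> iA; apply: contrapT => nA; apply: iA.
apply: sub_finite_set (finite_II n) => m Am /=; rewrite ltnNge.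
by apply/negP => nm; apply: nA; exists m.
Qed.

Lemma infinite_image_geq (g : nat -> nat) (A : set nat) :
  (forall k, k <= g k) -> infinite_set A -> infinite_set (g @` A).
Proof.
move=> gk iA /finite_nat_bounded[n gn].
have [m Am nm] := infinite_nat_unbounded n iA.
have /= := gn (g m) (imageP _ Am).
by rewrite ltnNge (leq_trans nm).
Qed.

(** Passage to a subsequence. Instead of the increasing enumeration of [M0] any
    [g] with values in [M0] and [k <= g k] will do: it is finite-to-one, so it
    maps infinite sets to infinite sets. *)
Lemma sequentially_pseudocompact_sub (X : topologicalType)
    (U_ : nat -> set X) (M0 : set nat) :
  sequentially_pseudocompact X -> infinite_set M0 ->
  (forall n, M0 n -> open (U_ n) /\ U_ n !=set0) ->
  exists (x : X) (M : set nat), [/\ infinite_set M, M `<=` M0 &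
    forall U : set _, nbhs x U ->
      finite_set [set n | M n /\ U_ n `&` U = set0]].
Proof.
move=> sX iM0 oU.
have /(_ _)/cid2 Hg k : exists2 m, M0 m & k <= m.
  exact: infinite_nat_unbounded.
pose g k := s2val (Hg k).
have gM0 k : M0 (g k) by exact: (s2valP (Hg k)).
have gk k : k <= g k by exact: (s2valP' (Hg k)).
have [x [M [iM xM]]] := sX (U_ \o g) (fun k => oU _ (gM0 k)).
exists x, (g @` M); split; first exact: infinite_image_geq.
  by move=> _ [k _ <-].
move=> U /xM; move/(finite_image g); apply: sub_finite_set.
by move=> _ [[k Mk <-] UU]; exists k.
Qed.

(** The usual diagonal argument: with [M_ k] decreasing and [Q k (M_ k)], a set
    made of one [m k >= k] from each [M_ k] is contained in every [M_ k] up to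
    finitely many elements. *)
Lemma diagonal_infinite (Q : nat -> set nat -> Prop) :
  (forall k M0, infinite_set M0 ->
     exists M, [/\ infinite_set M, M `<=` M0 & Q k M]) ->
  (forall k M M', Q k M -> finite_set (M' `\` M) -> Q k M') ->
  exists M, infinite_set M /\ forall k, Q k M.
Proof.
move=> Qsub Qfin.
have /choice[step Hstep] (kM : nat * set nat) : exists M, infinite_set kM.2 ->
    [/\ infinite_set M, M `<=` kM.2 & Q kM.1 M].
  have [iM|fM] := pselect (infinite_set kM.2); last by exists setT.
  by have [M HM] := Qsub kM.1 _ iM; exists M.
pose M_ := fix M_ k := step (k, if k is k'.+1 then M_ k' else setT).
have iM k : infinite_set (M_ k).
  elim: k => [|k IH] /=; last by have [] := Hstep (k.+1, M_ k) IH.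
  by have [] := Hstep (0, setT) infinite_nat.
have QM k : Q k (M_ k).
  case: k => [|k] /=; last by have [] := Hstep (k.+1, M_ k) (iM k).
  by have [] := Hstep (0, setT) infinite_nat.
have MS k : M_ k.+1 `<=` M_ k by have [] := Hstep (k.+1, M_ k) (iM k).
have Mle j k : j <= k -> M_ k `<=` M_ j.
  elim: k => [|k IH]; first by rewrite leqn0 => /eqP ->.
  rewrite leq_eqVlt => /orP[/eqP -> //|]; rewrite ltnS => /IH.
  exact: subset_trans.
have /(_ _)/cid2 Hm k : exists2 m, M_ k m & k <= m.
  exact: infinite_nat_unbounded.
pose m k := s2val (Hm k).
exists (range m); split.
  apply: infinite_image_geq infinite_nat => k; exact: (s2valP' (Hm k)).
move=> k; apply: (Qfin k (M_ k)) => //.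
apply: sub_finite_set (finite_image m (finite_II k)).
move=> _ [[j _ <-] nMj]; exists j => //=; rewrite ltnNge; apply/negP => kj.
by apply: nMj; apply: Mle kj _ _; exact: (s2valP (Hm j)).
Qed.

Lemma prod_sequentially_pseudocompact (I : Type) (X : I -> topologicalType) :
  inhabited I -> (forall i, sequentially_pseudocompact (X i)) ->
  sequentially_pseudocompact (prod_topology X).
Proof.
move=> [i0] sX U_ oU.
have /(_ _)/cid Hp n : U_ n !=set0 by case: (oU n).
pose p n := sval (Hp n).
have /choice[D] n : exists D : seq {classic I}, exists V : forall i, set (X i),
    (forall i, nbhs (p n i) (V i)) /\
    [set y : prod_topology X | forall i, i \in D -> V i (y i)] `<=` U_ n.
  apply: prod_nbhs_box; apply: open_nbhs_nbhs.
  by split; [case: (oU n)|exact: svalP].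
move=> /choice[V HV].
pose W n i : set (X i) := (V n i)°.
have oW i n : open (W n i) /\ W n i !=set0.
  by split; [exact: open_interior|exists (p n i); have [/(_ i)] := HV n].
(* [j] lists every coordinate constrained by some box: [k] codes a pair (n, l)
   and [j k] is the [l]-th coordinate of [D n]. *)
pose j k : I := nth (i0 : {classic I}) (D (odflt (0, 0) (unpickle k)).1)
                    (odflt (0, 0) (unpickle k)).2.
have jD n i : i \in D n -> exists k, j k = i.
  move=> iD; exists (pickle (n, index i (D n))).
  by rewrite /j pickleK /= nth_index.
pose Q i M := exists x : X i, forall U : set (X i), nbhs x U ->
  finite_set [set n | M n /\ W n i `&` U = set0].
have [M [iM QM]] : exists M, infinite_set M /\ forall k, Q (j k) M.
  apply: diagonal_infinite => [k M0 iM0|k M M' [x xM] fM].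
    have [x [M [iM MM0 xM]]] := sequentially_pseudocompact_sub (sX (j k)) iM0
       (fun n _ => oW (j k) n).
    by exists M; split=> //; exists x.
  exists x => U /xM fU; apply: sub_finite_set (_ : finite_set (_ `|` _)).
    2: by rewrite finite_setU; split; [exact: fU|exact: fM].
  move=> n [M'n WU]; have [Mn|nMn] := pselect (M n); first by left.
  by right.
have /(_ _)/cid Hx i : exists x : X i, (exists k, j k = i) ->
    forall U : set _, nbhs x U ->
      finite_set [set n | M n /\ W n i `&` U = set0].
  have [[k <-]|nk] := pselect (exists k, j k = i).
    by have [x Hx] := QM k; exists x.
  by exists (p 0 i).
exists (fun i => sval (Hx i)), M; split=> // U /prod_nbhs_box[E [T [Tx TU]]].
(* The indices [n] that some constrained coordinate [i] of [U] rules out. *)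
pose bad i := [set n | (exists k, j k = i) /\ (M n /\ W n i `&` T i = set0)].
have fbad : finite_set (\bigcup_(i in [set` E]) bad i).
  apply: bigcup_finite; first exact: finite_seq.
  move=> i _; have [ji|nji] := pselect (exists k, j k = i).
    by apply: sub_finite_set (svalP (Hx i) ji _ (Tx i)) => n [].
  by apply: sub_finite_set (finite_set0 _) => n [].
apply: sub_finite_set fbad => n [Mn UU]; apply: contrapT => nbad.
have [_ VU] := HV n.
(* For [i] in [E] but unlisted by [j], the box of [U_ n] leaves [i] free, so the
   coordinate of the limit itself can be used. *)
have /(_ _)/cid Hz i : exists z : X i,
    (i \in (E : seq {classic I}) -> T i z) /\
    (i \in (D n : seq {classic I}) -> W n i z).
  have [iE|iE] := boolP (i \in (E : seq {classic I})); last first.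
    by exists (p n i); split=> // _; have [/(_ i)] := HV n.
  have [ji|nji] := pselect (exists k, j k = i).
    have /set0P[z [Wz Tz]] : W n i `&` T i != set0.
      by apply/eqP => WT; apply: nbad; exists i.
    by exists z.
  exists (sval (Hx i)); split=> [_|/jD//]; exact: nbhs_singleton.
suff : (U_ n `&` U) (fun i => sval (Hz i)) by rewrite UU.
split; [apply: VU|apply: TU] => i iD; have [zE zD] := svalP (Hz i).
  by apply: interior_subset; exact: zD.
exact: zE.
Qed.

(** * Open pieces around a point of a pseudocompact space *)

Section Stars.
Variables (X : topologicalType) (o : X) (J : Type) (P : J -> set X).
Hypothesis P_open : forall j, open (P j).
Hypothesis P_disjoint : forall j k, P j `&` P k !=set0 -> j = k.
Hypothesis P_cover : forall x, x = o \/ exists j, P j x.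
Hypothesis X_pseudocompact : pseudocompact X.

(** The sets [P j `\` closure V] form a locally finite family: [V] misses all of
    them and [P j] meets only the one with index [j]. *)
Lemma star_finite_rest (V : set X) : nbhs o V ->
  exists2 F : set (set X),
    finite_set F /\ ~` closure V `<=` \bigcup_(A in F) A &
    forall A, F A -> exists j, A `<=` P j.
Proof.
move=> Vo.
pose F := [set A : set X | A !=set0 /\ exists j, A = P j `\` closure V].
exists F; last by move=> _ [_ [j ->]]; exists j => x [].
split; last first.
  move=> x Vx; have [xo|[j Pjx]] := P_cover x.
    by case: Vx; apply: subset_closure; rewrite xo; exact: nbhs_singleton.
  by exists (P j `\` closure V) => //; split; [exists x|exists j].
apply: X_pseudocompact.
  move=> A [A0 [j AE]]; split=> //; rewrite AE.
  rewrite setDE; apply: openI => //; exact/closed_openC/closed_closure.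
move=> x; have [->|[j Pjx]] := P_cover x.
  exists V => //; apply: sub_finite_set (finite_set0 _).
  move=> A [[_ [j ->]] [y [[_ nVy] Vy]]]; apply: nVy; exact: subset_closure.
exists (P j); first by apply: open_nbhs_nbhs.
apply: sub_finite_set (finite_set1 (P j `\` closure V)).
move=> _ [[_ [k ->]] [y [[Pky _] Pjy]]] /=.
by rewrite (@P_disjoint k j)//; exists y.
Qed.

Variables (Z : topologicalType) (g : J -> Z -> X).
Hypothesis g_continuous : forall j, continuous (g j).
Hypothesis P_range : forall j, P j `<=` range (g j).

(** With [A] and [B] disjoint neighbourhoods of [f o] and [y], the trace of [B]
    avoids the closure of the trace of [A], so it lies in a finite union of
    subsets of the closed sets [range (f \o g j)]. *)
Lemma star_H_closed : hausdorff_space X -> H_closed Z -> H_closed X.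
Proof.
move=> hX /H_closed_theta_compact tZ; split=> // Y f hY [_ cf _] y yf.
apply: contrapT => nfy.
have yo : f o != y by apply/eqP => foy; apply: nfy; exists o.
have := hY; rewrite open_hausdorff => /(_ _ _ yo)[[A B] [/= Ao By] [oA oB AB]].
rewrite !inE in Ao By.
have [|F [finF VF] FP] := @star_finite_rest (f @^-1` A).
  by apply: cf; exact: open_nbhs_nbhs.
have BF : f @^-1` B `<=` \bigcup_(C in F) C.
  move=> x Bx; apply: VF => /(_ (f @^-1` B))[|t [At Bt]].
    by apply: open_nbhs_nbhs; split=> //; exact: (continuousP _).1.
  by move/eqP/seteqP: AB => [/(_ (f t)) AB _]; exact: AB.
have cF : closed (\bigcup_(C in F) closure (f @` C)).
  by apply: closed_bigcup => // C _; exact: closed_closure.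
have [C FC yC] : (\bigcup_(C in F) closure (f @` C)) y.
  apply: cF => W Wy; have [_ [[x _ <-] [Bx Wx]]] : range f `&` (B `&` W) !=set0.
    by apply: yf; apply: filterI => //; exact: open_nbhs_nbhs.
  have [C FC Cx] := BF x Bx.
  by exists (f x); split=> //; exists C => //; apply: subset_closure; exists x.
have [j CPj] := FP C FC.
have : closed (range (f \o g j)).
  apply: theta_compact_closed_range => // z.
  by apply: continuous_comp; [exact: g_continuous|exact: cf].
move=> /closure_id E; apply: nfy.
have : closure (range (f \o g j)) y.
  apply: closureS yC => _ [x Cx <-].
  by have [z _ <-] := P_range (CPj x Cx); exists z.
by rewrite -E => -[z _ <-]; exists (g j z).
Qed.

(** If no piece meets infinitely many [U_ n], then [o] is the accumulation point:
    a [U_ n] disjoint from [V] misses [closure V], hence meets one of the finitely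
    many pieces that remain. *)
Lemma star_sequentially_pseudocompact :
  sequentially_pseudocompact Z -> sequentially_pseudocompact X.
Proof.
move=> sZ U_ oU.
have [[j iM0]|nj] :=
    pselect (exists j, infinite_set [set n | U_ n `&` P j !=set0]).
  have [|z [M [iM MM0 zM]]] := sequentially_pseudocompact_sub
      (U_ := fun n => g j @^-1` (U_ n)) sZ iM0.
    move=> n [x [Ux /P_range[z _ zx]]]; split; last by exists z; rewrite /= zx.
    by apply: (continuousP _).1; [exact: g_continuous|case: (oU n)].
  exists (g j z), M; split=> // U /g_continuous/zM; apply: sub_finite_set.
  move=> n [Mn UU]; split=> //.
  by apply/seteqP; split=> // t [Ut tU]; rewrite -[set0 _]/(set0 (g j t)) -UU.
exists o, setT; split; first exact: infinite_nat.
move=> V Vo; have [F [finF VF] FP] := star_finite_rest Vo.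
have fbad : finite_set (\bigcup_(A in F) [set n | U_ n `&` A !=set0]).
  apply: bigcup_finite => // A /FP[j APj].
  have : finite_set [set n | U_ n `&` P j !=set0].
    by apply: contrapT => ij; apply: nj; exists j.
  by apply: sub_finite_set => n [x [Ux Ax]]; exists x; split=> //; exact: APj.
apply: sub_finite_set fbad => n [_ UV].
have [oUn [x Ux]] := oU n.
have [|A FA Ax] := VF x; last by exists A => //; exists x.
move=> /(_ (U_ n))[|t [Vt Ut]]; first exact: open_nbhs_nbhs.
by rewrite -[False]/(set0 t) -UV.
Qed.

End Stars.

(** * Brandt extensions *)

Section Brandt.
Variables (S : semitopologicalMonoid0) (L : Type).
Implicit Types (a b c d : L) (s t : S).

Lemma brandt_elt0 a b : brandt_elt a (smzero S) b = BrandtZero.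
Proof. by rewrite /brandt_elt insubF // eqxx. Qed.

Lemma brandt_eltE a (u : {s : S | s != smzero S}) b :
  brandt_elt a (val u) b = BrandtElt a u b.
Proof. by rewrite /brandt_elt valK. Qed.

Lemma brandt_mul_elt a s b c t d :
  brandt_mul (brandt_elt a s b) (brandt_elt c t d) =
  if `[< b = c >] then brandt_elt a (smmul s t) d else BrandtZero.
Proof.
rewrite {1 2}/brandt_elt; case: insubP => [u _ <-|]; last first.
  by rewrite negbK => /eqP ->; rewrite smmul0l brandt_elt0; case: ifP.
case: insubP => [v _ <-|] //=.
by rewrite negbK => /eqP ->; rewrite smmul0r brandt_elt0; case: ifP.
Qed.

Definition brandt_piece (ab : L * L) : set (brandt S L) :=
  [set x | exists u, x = BrandtElt ab.1 u ab.2].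

(** The two-sided product with the idempotents [(a, 1, a)] and [(b, 1, b)] fixes
    the piece with index [(a, b)] and kills everything else; this exhibits the
    piece as the preimage of an open set under translations. *)
Lemma brandt_pieceE ab : brandt_piece ab =
  [set x | brandt_mul (brandt_mul (brandt_elt ab.1 (smone S) ab.1) x)
             (brandt_elt ab.2 (smone S) ab.2) <> BrandtZero].
Proof.
case: ab => a b; apply/seteqP; split=> [_ [u ->]|x] /=.
  rewrite -brandt_eltE !brandt_mul_elt !asboolT // brandt_mul_elt asboolT //.
  by rewrite smmul1l smmul1r brandt_eltE.
case: x => [|c u d].
  rewrite -(brandt_elt0 a b) brandt_mul_elt smmul0r brandt_elt0 if_same.
  by rewrite -(brandt_elt0 a b) brandt_mul_elt smmul0l brandt_elt0 if_same.
rewrite -brandt_eltE brandt_mul_elt; case: asboolP => [<-|_] //.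
rewrite brandt_mul_elt; case: asboolP => [->|_] // _.
by exists u; rewrite brandt_eltE.
Qed.

Variable tau : topology_on (brandt S L).
Hypothesis tau_brandt : topological_brandt tau.
Local Notation B := (space_of tau).

Lemma brandt_piece_open ab : open (brandt_piece ab : set B).
Proof.
case: tau_brandt => -[hB _ cl cr] _; rewrite brandt_pieceE.
have oZ : open (~` [set BrandtZero] : set B).
  apply: closed_openC.
  exact: (accessible_closed_set1 (hausdorff_accessible hB)).
have := (continuousP _).1 (cl (brandt_elt ab.1 (smone S) ab.1)) _
  ((continuousP _).1 (cr (brandt_elt ab.2 (smone S) ab.2)) _ oZ).
by [].
Qed.

(** The definition gives continuity for one diagonal block [(c, c)] only; the
    identity [(a, 1, c) (c, s, c) (c, 1, b) = (a, s, b)] carries it to all blocks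
    by translations. *)
Lemma brandt_elt_continuous a b :
  continuous (fun s => brandt_elt a s b : B).
Proof.
case: tau_brandt => -[_ _ cl cr] [c [_ cc _]].
have -> : (fun s => brandt_elt a s b : B) = (fun s => brandt_mul
    (brandt_mul (brandt_elt a (smone S) c) (brandt_elt c s c))
    (brandt_elt c (smone S) b)).
  apply/funext => s; rewrite brandt_mul_elt asboolT // brandt_mul_elt asboolT //.
  by rewrite smmul1l smmul1r.
move=> s.
apply: (@continuous_comp _ B B (fun s => brandt_mul (brandt_elt a (smone S) c)
   (brandt_elt c s c)) (fun x => brandt_mul x (brandt_elt c (smone S) b)));
  last exact: cr.
apply: (@continuous_comp _ B B (fun s => brandt_elt c s c)
  (brandt_mul (brandt_elt a (smone S) c))); [exact: cc|exact: cl].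
Qed.

Hypothesis tau_pseudocompact : pseudocompact B.

Let piece_disjoint ab cd :
  (brandt_piece ab `&` brandt_piece cd : set B) !=set0 -> ab = cd.
Proof. by case: ab cd => [a b] [c d] [_ [[u ->] [v /= [-> _ ->]]]]. Qed.

Let piece_cover (x : B) : x = BrandtZero \/ exists ab, brandt_piece ab x.
Proof. by case: x => [|a u b]; [left|right; exists (a, b), u]. Qed.

Let piece_range ab :
  brandt_piece ab `<=` range (fun s => brandt_elt ab.1 s ab.2).
Proof. by move=> _ [u ->]; exists (val u); rewrite // brandt_eltE. Qed.

Lemma brandt_H_closed : H_closed S -> H_closed B.
Proof.
move=> hS; apply: (star_H_closed brandt_piece_open piece_disjoint piece_cover
  tau_pseudocompact _ piece_range) => //.
  by move=> ab; exact: brandt_elt_continuous.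
by case: tau_brandt => -[].
Qed.

Lemma brandt_sequentially_pseudocompact :
  sequentially_pseudocompact S -> sequentially_pseudocompact B.
Proof.
apply: (star_sequentially_pseudocompact brandt_piece_open piece_disjoint
  piece_cover tau_pseudocompact _ piece_range).
by move=> ab; exact: brandt_elt_continuous.
Qed.

End Brandt.

Unset Implicit Arguments.

Theorem corollary2p28 (I : Type) (I_nonempty : inhabited I)
    (L : I -> Type) (L_nonempty : forall i : I, inhabited (L i))
    (S : I -> semitopologicalMonoid0)
    (tau : forall i : I, topology_on (brandt (S i) (L i)))
    (tau_brandt : forall i : I, topological_brandt (tau i))
    (tau_pseudocompact : forall i : I, pseudocompact (space_of (tau i))) :
  let X : I -> topologicalType := fun i => space_of (tau i) in
  let op : prod_topology X -> prod_topology X -> prod_topology X :=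
    @product_mul I X (fun i => @brandt_mul (S i) (L i)) in
  ((forall i : I, H_closed (S i)) ->
     semitopological_semigroup op /\ H_closed (prod_topology X)) /\
  ((forall i : I, sequentially_pseudocompact (S i)) ->
     semitopological_semigroup op /\ sequentially_pseudocompact (prod_topology X)).
Proof.
move=> X op.
have sop : semitopological_semigroup op.
  by apply: prod_semitopological => i; case: (tau_brandt i).
split=> hS; split=> //.
  by apply: prod_H_closed => i; exact: brandt_H_closed.
by apply: prod_sequentially_pseudocompact => // i;
  exact: brandt_sequentially_pseudocompact.
Qed.
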